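(* The group $Q\mathcal{B}_3$ is torsion free and its center is the cyclic group generated by $\mathbf{\Delta}=\gamma_1\gamma_2\gamma_1\gamma_2\gamma_1\gamma_2$.
   Context: $Q\mathcal{B}_3=\pi_1(Q\mathcal{C}_3)$, where $Q\mathcal{C}_3$ is the space of unordered configurations $\{z_1,z_2,z_3\}$ of three distinct complex numbers such that $z_i+z_j\neq 2z_k$ whenever $\{i,j,k\}=\{1,2,3\}$, with base point $\{0,1,3\}$. The elements $\gamma_1,\gamma_2$ are the classes of the loops $\gamma_1(t)=\{\frac12-\frac12e^{\pi it},\frac12+\frac12e^{\pi it},3\}$ and $\gamma_2(t)=\{0,2-e^{\pi it},2+e^{\pi it}\}$, $t\in[0,1]$; the group has the presentation $Q\mathcal{B}_3=\langle\gamma_1,\gamma_2\mid\gamma_1\gamma_2\gamma_1\gamma_2\gamma_1\gamma_2=\gamma_2\gamma_1\gamma_2\gamma_1\gamma_2\gamma_1\rangle$. *)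

(* Defs.v *)
From HB Require Import structures.
From mathcomp Require Import all_boot all_order all_algebra generic_quotient.
From mathcomp Require Import all_classical reals topology normedtype trigo.
From mathcomp Require Import homotopy lra ring.
From mathcomp.real_closed Require Import complex.

Set Implicit Arguments.
Unset Strict Implicit.
Unset Printing Implicit Defensive.

Import Order.TTheory GRing.Theory Num.Theory.
Import numFieldNormedType.Exports.

Local Open Scope classical_set_scope.
Local Open Scope ring_scope.
Local Open Scope complex_scope.
Local Open Scope quotient_scope.

Definition unit_interval (R : realType) : Type := set_type (`[0, 1]%classic : set R).

HB.instance Definition _ (R : realType) := Topological.on (unit_interval R).

Section UnitInterval.
Context {R : realType}.
Local Notation I := (unit_interval R).

Lemma clamp_subproof (x : R) : Num.max 0 (Num.min 1 x) \in (`[0, 1]%classic : set R).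
Proof.
by apply/mem_set; rewrite /= in_itv /= le_max lexx /= ge_max ler01 ge_min lexx.
Qed.

Definition clamp (x : R) : I :=
  exist _ (Num.max 0 (Num.min 1 x)) (clamp_subproof x).

Lemma unit_intervalP (t : I) : 0 <= set_val t <= 1.
Proof. by have := set_valP t; rewrite /= in_itv. Qed.

Lemma val_clamp (x : R) : 0 <= x <= 1 -> set_val (clamp x) = x.
Proof.
by move=> /andP[x0 x1]; rewrite set_valE /= (min_idPr x1) (max_idPr x0).
Qed.

Lemma clampK (t : I) : clamp (set_val t) = t.
Proof. by apply: val_inj; rewrite -!set_valE val_clamp// unit_intervalP. Qed.

Lemma val_continuous : continuous (set_val : I -> R).
Proof. exact: initial_continuous. Qed.

Lemma clamp_continuous : continuous clamp.
Proof.
apply: continuous_comp_initial.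
rewrite (_ : set_val \o clamp = fun x => Num.max 0 (Num.min 1 x)); last first.
  by apply/funext => x; rewrite /= set_valE.
move=> x; apply: (@continuous_max R R (cst 0) (cst 1 \min id)).
  exact: cst_continuous.
by apply: continuous_min; [exact: cst_continuous|exact: cvg_id].
Qed.

Lemma zero_one_subproof : clamp 0 != clamp 1.
Proof.
apply/eqP => /(congr1 set_val); rewrite !val_clamp ?lexx ?ler01//.
by move/eqP; rewrite eq_sym oner_eq0.
Qed.

HB.instance Definition _ := isBiPointed.Build I zero_one_subproof.

Lemma val_zero : set_val (zero : I) = 0.
Proof. by rewrite val_clamp ?lexx ?ler01. Qed.

Lemma val_one : set_val (one : I) = 1.
Proof. by rewrite val_clamp ?lexx ?ler01. Qed.

End UnitInterval.

Ltac case_minmax := repeat match goal with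
  | |- context [Order.min ?a ?b] =>
      lazymatch b with context [Order.min _ _] => fail
      | _ => case: (leP a b) => ? end
  | |- context [Order.max ?a ?b] => case: (leP a b) => ?
  end.

Section RealContinuity.
Context {R : realType} {Z : topologicalType} (a b : Z -> R).
Context (ca : continuous a) (cb : continuous b).

Lemma ctsD : continuous (fun z => a z + b z).
Proof. by move=> z; apply: cvgD; [exact: ca|exact: cb]. Qed.

Lemma ctsB : continuous (fun z => a z - b z).
Proof. by move=> z; apply: cvgB; [exact: ca|exact: cb]. Qed.

Lemma ctsM : continuous (fun z => a z * b z).
Proof. by move=> z; apply: cvgM; [exact: ca|exact: cb]. Qed.

Lemma cts_min : continuous (fun z => Num.min (a z) (b z)).
Proof.
by move=> z; apply: (@continuous_min R Z a b); [exact: ca|exact: cb].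
Qed.

Lemma cts_max : continuous (fun z => Num.max (a z) (b z)).
Proof.
by move=> z; apply: (@continuous_max R Z a b); [exact: ca|exact: cb].
Qed.
End RealContinuity.

Lemma cts_cst {Z T : topologicalType} (c : T) : continuous (fun _ : Z => c).
Proof. exact: cst_continuous. Qed.

Lemma cts_comp {X Y Z : topologicalType} (g : X -> Y) (f : Y -> Z) :
  continuous g -> continuous f -> continuous (fun x => f (g x)).
Proof. by move=> cg cf x; apply: continuous_comp; [exact: cg|exact: cf]. Qed.

Lemma cts_pair {X Y Z : topologicalType} (g : X -> Y) (f : X -> Z) :
  continuous g -> continuous f -> continuous (fun x => (g x, f x)).
Proof. by move=> cg cf x; apply: cvg_pair; [exact: cg|exact: cf]. Qed.

Lemma cts_fst {X Y : topologicalType} : continuous (@fst X Y).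
Proof. by move=> x; exact: cvg_fst. Qed.

Lemma cts_snd {X Y : topologicalType} : continuous (@snd X Y).
Proof. by move=> x; exact: cvg_snd. Qed.

Section Homotopy.
Context {R : realType} {T : topologicalType}.
Local Notation I := (unit_interval R).

Definition homotopic (x y : T) (p q : {path I from x to y}) : Prop :=
  exists H : I * I -> T, [/\ continuous H,
    forall t, H (zero, t) = p t, forall t, H (one, t) = q t,
    forall s, H (s, zero) = x & forall s, H (s, one) = y].

Lemma paste_continuous (Z : topologicalType) (a : Z -> R) (f g : Z -> T) :
  continuous a -> continuous f -> continuous g ->
  (forall z, a z = 2^-1 -> f z = g z) ->
  continuous (fun z => if a z <= 2^-1 then f z else g z).
Proof.
move=> ca cf cg fg; apply/continuous_subspace_setT.
have -> : [set: Z] = a @^-1` [set x | x <= 2^-1] `|` a @^-1` [set x | 2^-1 <= x].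
  by apply/seteqP; split => // z _ /=; apply/orP; exact: le_total.
apply: withinU_continuous.
- by apply: (closed_comp (fun x _ => ca x)); exact: closed_le.
- by apply: (closed_comp (fun x _ => ca x)); exact: closed_ge.
- apply: (subspace_eq_continuous (f := f)); last exact: continuous_subspaceT.
  by move=> z; rewrite inE /= => az; rewrite /from_subspace /= ifT.
- apply: (subspace_eq_continuous (f := g)); last exact: continuous_subspaceT.
  move=> z; rewrite inE /= => za; rewrite /from_subspace /=; case: ifPn => // az.
  by rewrite fg//; apply/eqP; rewrite eq_le az za.
Qed.

Definition concat_fun (f g : I -> T) (t : I) : T :=
  if set_val t <= 2^-1 then f (clamp (2 * set_val t))
  else g (clamp (2 * set_val t - 1)).

Lemma double_continuous (Z : topologicalType) (a : Z -> R) :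
  continuous a -> continuous (fun z => clamp (2 * a z) : I).
Proof.
move=> ca; apply: cts_comp clamp_continuous.
by apply: ctsM => //; exact: cts_cst.
Qed.

Lemma doubleB_continuous (Z : topologicalType) (a : Z -> R) :
  continuous a -> continuous (fun z => clamp (2 * a z - 1) : I).
Proof.
move=> ca; apply: cts_comp clamp_continuous.
by apply: ctsB; [apply: ctsM => //|]; exact: cts_cst.
Qed.

Lemma concat_fun_continuous (f g : I -> T) :
  continuous f -> continuous g -> f one = g zero ->
  continuous (concat_fun f g).
Proof.
move=> cf cg fg; apply: paste_continuous => [|||t ->].
- exact: val_continuous.
- apply: cts_comp cf.
  by apply: double_continuous; exact: val_continuous.
- apply: cts_comp cg.
  by apply: doubleB_continuous; exact: val_continuous.
- by rewrite mulfV ?pnatr_eq0// subrr.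
Qed.

Section Concat.
Context (x y z : T) (p : {path I from x to y}) (q : {path I from y to z}).

Lemma concat_continuous : continuous (concat_fun p q).
Proof.
by apply: concat_fun_continuous; rewrite ?path_one ?path_zero//; exact: cts_fun.
Qed.

Lemma concat_zero : concat_fun p q zero = x.
Proof.
rewrite /concat_fun val_zero invr_ge0 ler0n mulr0.
exact: (@path_zero _ _ _ _ p).
Qed.

Lemma concat_one : concat_fun p q one = z.
Proof.
rewrite /concat_fun val_one ifF; last by lra.
apply: etrans (@path_one _ _ _ _ q).
by congr (q (clamp _)); lra.
Qed.

Definition concat : {path I from x to z} :=
  mk_path concat_continuous concat_zero concat_one.
End Concat.

Definition rev_time (t : I) : I := clamp (1 - set_val t).

Lemma rev_time_continuous : continuous rev_time.
Proof.
apply: cts_comp clamp_continuous.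
by apply: ctsB; [exact: cts_cst|exact: val_continuous].
Qed.

Lemma rev_time_zero : rev_time zero = one.
Proof. by rewrite /rev_time val_zero subr0. Qed.

Lemma rev_time_one : rev_time one = zero.
Proof. by rewrite /rev_time val_one subrr. Qed.

Section Reverse.
Context (x y : T) (p : {path I from x to y}).

Lemma reverse_continuous : continuous (p \o rev_time).
Proof.
by apply: cts_comp; [exact: rev_time_continuous|exact: cts_fun].
Qed.

Lemma reverse_zero : (p \o rev_time) zero = y.
Proof. by rewrite /= rev_time_zero path_one. Qed.

Lemma reverse_one : (p \o rev_time) one = x.
Proof. by rewrite /= rev_time_one path_zero. Qed.

Definition reverse : {path I from y to x} :=
  mk_path reverse_continuous reverse_zero reverse_one.
End Reverse.

Definition const_path (x : T) : {path I from x to x} := cst x.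

Lemma homotopic_refl x y (p : {path I from x to y}) : homotopic p p.
Proof.
exists (p \o snd); split => //= [|_|_]; rewrite ?path_zero ?path_one//.
by apply: cts_comp; [exact: cts_snd|exact: cts_fun].
Qed.

Lemma homotopic_sym x y (p q : {path I from x to y}) :
  homotopic p q -> homotopic q p.
Proof.
move=> [H [cH H0 H1 Hx Hy]]; exists (fun u => H (rev_time u.1, u.2)).
split => [|t|t|s|s]; rewrite /= ?rev_time_zero ?rev_time_one//.
apply: cts_comp cH; apply: cts_pair cts_snd.
exact: cts_comp cts_fst rev_time_continuous.
Qed.

Lemma val_fst_continuous : continuous (fun u : I * I => set_val u.1 : R).
Proof.
exact: cts_comp cts_fst val_continuous.
Qed.

Lemma val_snd_continuous : continuous (fun u : I * I => set_val u.2 : R).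
Proof.
exact: cts_comp cts_snd val_continuous.
Qed.

Lemma homotopic_trans x y (p q r : {path I from x to y}) :
  homotopic p q -> homotopic q r -> homotopic p r.
Proof.
move=> [H [cH H0 H1 Hx Hy]] [K [cK K0 K1 Kx Ky]].
exists (fun u => if (set_val u.1 : R) <= 2^-1 then H (clamp (2 * set_val u.1), u.2)
                 else K (clamp (2 * set_val u.1 - 1), u.2)).
split => [|t|t|s|s] /=.
- apply: paste_continuous => [|||u ->].
  + exact: val_fst_continuous.
  + apply: cts_comp cH.
    apply: cts_pair cts_snd.
    by apply: double_continuous; exact: val_fst_continuous.
  + apply: cts_comp cK.
    apply: cts_pair cts_snd.
    by apply: doubleB_continuous; exact: val_fst_continuous.
  + by rewrite mulfV ?pnatr_eq0// subrr H1 K0.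
- by rewrite val_zero invr_ge0 ler0n mulr0 H0.
- rewrite val_one ifF; last by lra.
  by rewrite -K1; congr (K (clamp _, _)); lra.
- by rewrite Hx Kx; case: ifP.
- by rewrite Hy Ky; case: ifP.
Qed.

Lemma concat_homotopic x y z (p p' : {path I from x to y})
    (q q' : {path I from y to z}) :
  homotopic p p' -> homotopic q q' -> homotopic (concat p q) (concat p' q').
Proof.
move=> [H [cH H0 H1 Hx Hy]] [K [cK K0 K1 Kx Ky]].
exists (fun u => concat_fun (fun t => H (u.1, t)) (fun t => K (u.1, t)) u.2).
split => [|t|t|s|s]; rewrite /= /concat_fun.
- apply: paste_continuous => [|||u ->].
  + exact: val_snd_continuous.
  + apply: cts_comp cH.
    apply: cts_pair cts_fst _.
    by apply: double_continuous; exact: val_snd_continuous.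
  + apply: cts_comp cK.
    apply: cts_pair cts_fst _.
    by apply: doubleB_continuous; exact: val_snd_continuous.
  + by rewrite mulfV ?pnatr_eq0// subrr Hy Kx.
- by rewrite /= H0 K0.
- by rewrite /= H1 K1.
- by rewrite val_zero invr_ge0 ler0n mulr0 Hx.
- rewrite val_one ifF; last by lra.
  by rewrite -[RHS](Ky s); congr (K (_, clamp _)); lra.
Qed.

(* Any two reparametrizations of the same map with equal endpoints are
   homotopic, by linear interpolation of the parameters. *)
Lemma reparam_homotopic (X : T) (Y : T) (p q : {path I from X to Y})
    (f : I -> T) (a b : I -> R) :
  continuous f -> continuous a -> continuous b ->
  (forall t, 0 <= a t <= 1) -> (forall t, 0 <= b t <= 1) ->
  a zero = b zero -> a one = b one ->
  (forall t, p t = f (clamp (a t))) -> (forall t, q t = f (clamp (b t))) ->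
  homotopic p q.
Proof.
move=> cf ca cb ha hb ab0 ab1 pE qE.
exists (fun u : I * I =>
  f (clamp (a u.2 + set_val u.1 * (b u.2 - a u.2)))).
split => [|t|t|s|s] /=.
- have caS := cts_comp (@cts_snd I I) ca.
  have cbS := cts_comp (@cts_snd I I) cb.
  apply: cts_comp cf; apply: cts_comp clamp_continuous.
  apply: ctsD => //; apply: ctsM; first exact: val_fst_continuous.
  exact: ctsB.
- by rewrite val_zero mul0r addr0.
- by rewrite val_one mul1r addrC subrK.
- by rewrite ab0 subrr mulr0 addr0 -ab0 -pE path_zero.
- by rewrite ab1 subrr mulr0 addr0 -ab1 -pE path_one.
Qed.

Lemma affine_continuous (k l : R) : continuous (fun t : I => k * set_val t + l).
Proof.
apply: ctsD; last exact: cts_cst.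
by apply: ctsM; [exact: cts_cst|exact: val_continuous].
Qed.

Lemma concatA_homotopic x y z w (p : {path I from x to y})
    (q : {path I from y to z}) (r : {path I from z to w}) :
  homotopic (concat (concat p q) r) (concat p (concat q r)).
Proof.
pose a (t : I) : R := Num.min (2 * set_val t + 0)
  (Num.min (1 * set_val t + 4^-1) (2^-1 * set_val t + 2^-1)).
have ha t : 0 <= a t <= 1.
  have /andP[t0 t1] := unit_intervalP t.
  by rewrite /a; case_minmax; lra.
apply: (@reparam_homotopic _ _ _ _ (concat p (concat q r)) a set_val) => //.
- exact: cts_fun.
- by apply: cts_min; [|apply: cts_min]; exact: affine_continuous.
- exact: val_continuous.
- exact: unit_intervalP.
- by rewrite /a val_zero; case_minmax; lra.
- by rewrite /a val_one; case_minmax; lra.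
- move=> t; have := ha t; have /andP[] := unit_intervalP t.
  rewrite /= /mk_path /concat_fun => t0 t1 hat; rewrite (val_clamp hat).
  rewrite /= /mk_path /concat_fun.
  case: (leP (set_val t) 4^-1) => t4.
    have -> : a t = 2 * set_val t by rewrite /a; case_minmax; lra.
    rewrite ifT; last by lra.
    rewrite val_clamp; last by lra.
    by rewrite !ifT//; lra.
  case: (leP (set_val t) 2^-1) => t2.
    have -> : a t = set_val t + 4^-1 by rewrite /a; case_minmax; lra.
    rewrite val_clamp; last by lra.
    rewrite ifN; last by rewrite -ltNge; lra.
    rewrite ifN; last by rewrite -ltNge; lra.
    rewrite val_clamp; last by lra.
    rewrite ifT; last by lra.
    by congr (q (clamp _)); lra.
  have -> : a t = 2^-1 * set_val t + 2^-1 by rewrite /a; case_minmax; lra.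
  rewrite ifN; last by rewrite -ltNge; lra.
  rewrite val_clamp; last by lra.
  rewrite ifN; last by rewrite -ltNge; lra.
  by congr (r (clamp _)); lra.
- by move=> t; rewrite clampK.
Qed.

Lemma concat1_homotopic x y (p : {path I from x to y}) :
  homotopic (concat p (const_path y)) p.
Proof.
pose a (t : I) : R := Num.min (2 * set_val t + 0) 1.
have ha t : 0 <= a t <= 1.
  have /andP[t0 t1] := unit_intervalP t.
  by rewrite /a; case_minmax; lra.
apply: (@reparam_homotopic _ _ _ _ p a set_val) => //.
- exact: cts_fun.
- by apply: cts_min; [exact: affine_continuous|exact: cts_cst].
- exact: val_continuous.
- exact: unit_intervalP.
- by rewrite /a val_zero; case_minmax; lra.
- by rewrite /a val_one; case_minmax; lra.
- move=> t; have /andP[t0 t1] := unit_intervalP t.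
  rewrite /= /mk_path /concat_fun; case: ifPn; rewrite -?ltNge => t2.
    by congr (p (clamp _)); rewrite /a; case_minmax; lra.
  apply: etrans (esym (@path_one _ _ _ _ p)) _.
  by congr (p (clamp _)); rewrite /a; case_minmax; lra.
- by move=> t; rewrite clampK.
Qed.

Lemma concat0_homotopic x y (p : {path I from x to y}) :
  homotopic (concat (const_path x) p) p.
Proof.
pose a (t : I) : R := Num.max (2 * set_val t + -1) 0.
have ha t : 0 <= a t <= 1.
  have /andP[t0 t1] := unit_intervalP t.
  by rewrite /a; case_minmax; lra.
apply: (@reparam_homotopic _ _ _ _ p a set_val) => //.
- exact: cts_fun.
- by apply: cts_max; [exact: affine_continuous|exact: cts_cst].
- exact: val_continuous.
- exact: unit_intervalP.
- by rewrite /a val_zero; case_minmax; lra.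
- by rewrite /a val_one; case_minmax; lra.
- move=> t; have /andP[t0 t1] := unit_intervalP t.
  rewrite /= /mk_path /concat_fun; case: ifPn; rewrite -?ltNge => t2.
    apply: etrans (esym (@path_zero _ _ _ _ p)) _.
    by congr (p (clamp _)); rewrite /a; case_minmax; lra.
  by congr (p (clamp _)); rewrite /a; case_minmax; lra.
- by move=> t; rewrite clampK.
Qed.

Lemma concatV_homotopic x y (p : {path I from x to y}) :
  homotopic (concat p (reverse p)) (const_path x).
Proof.
pose a (t : I) : R := Num.min (2 * set_val t + 0) (-2 * set_val t + 2).
have ha t : 0 <= a t <= 1.
  have /andP[t0 t1] := unit_intervalP t.
  by rewrite /a; case_minmax; lra.
apply: (@reparam_homotopic _ _ _ _ p a (cst 0)) => //.
- exact: cts_fun.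
- by apply: cts_min; exact: affine_continuous.
- exact: cst_continuous.
- by move=> t /=; rewrite lexx ler01.
- by rewrite /a val_zero; case_minmax; rewrite /=; lra.
- by rewrite /a val_one; case_minmax; rewrite /=; lra.
- move=> t; have /andP[t0 t1] := unit_intervalP t.
  rewrite /= /mk_path /concat_fun; case: ifPn; rewrite -?ltNge => t2.
    by congr (p (clamp _)); rewrite /a; case_minmax; lra.
  rewrite /= /rev_time val_clamp; last by lra.
  by congr (p (clamp _)); rewrite /a; case_minmax; lra.
- by move=> t /=; apply: etrans (esym (@path_zero _ _ _ _ p)) _.
Qed.

Lemma reverse_homotopic x y (p q : {path I from x to y}) :
  homotopic p q -> homotopic (reverse p) (reverse q).
Proof.
move=> [H [cH H0 H1 Hx Hy]]; exists (fun u => H (u.1, rev_time u.2)).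
split => [|t|t|s|s]; rewrite /= ?rev_time_zero ?rev_time_one//.
- apply: cts_comp cH; apply: cts_pair cts_fst _.
  exact: cts_comp cts_snd rev_time_continuous.
- by rewrite H0.
- by rewrite H1.
Qed.

Lemma reverseK x y (p : {path I from x to y}) : reverse (reverse p) = p.
Proof.
apply/path_eqP => t; rewrite /= /mk_path /= /rev_time; congr (p _).
have /andP[t0 t1] := unit_intervalP t.
by rewrite -[RHS]clampK val_clamp ?subKr//; lra.
Qed.

End Homotopy.

Section FundamentalGroup.
Context (R : realType) (T : topologicalType) (x : T).
Local Notation I := (unit_interval R).
Local Notation loop := {path I from x to x}.

Definition homotopicb (p q : loop) : bool := `[< homotopic p q >].

Lemma homotopicb_equiv : equiv_class_of homotopicb.
Proof.
split=> [p|p q|q p r]; rewrite /homotopicb.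
- by apply/asboolP; exact: homotopic_refl.
- by apply/asboolP/asboolP; exact: homotopic_sym.
- by move=> /asboolP pq /asboolP qr; apply/asboolP; exact: homotopic_trans qr.
Qed.

Canonical homotopy_equiv := EquivRelPack homotopicb_equiv.

(* The fundamental group of [T] at [x]; the product of the classes of [p] and
   [q] is the class of [p] followed by [q]. *)
Definition pi1 := {eq_quot homotopy_equiv}.

HB.instance Definition _ := Choice.on pi1.
HB.instance Definition _ := EqQuotient.on pi1.

Definition path_class (p : loop) : pi1 := \pi_pi1 p.

Lemma path_classP (p q : loop) : path_class p = path_class q <-> homotopic p q.
Proof.
split => [/(@eqquotP _ _ pi1 p q)/asboolP//|pq].
by apply/(@eqquotP _ _ pi1 p q); exact/asboolP.
Qed.

Definition pi1_one : pi1 := path_class (const_path x).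
Definition pi1_mul (a b : pi1) : pi1 := path_class (concat (repr a) (repr b)).
Definition pi1_inv (a : pi1) : pi1 := path_class (reverse (repr a)).

Lemma repr_path_class (p : loop) : homotopic (repr (path_class p)) p.
Proof. by apply/path_classP; rewrite /path_class reprK. Qed.

Lemma pi1_ind (P : pi1 -> Prop) : (forall p, P (path_class p)) -> forall a, P a.
Proof. by move=> h a; rewrite -[a]reprK; exact: h. Qed.

Lemma pi1_mulE (p q : loop) :
  pi1_mul (path_class p) (path_class q) = path_class (concat p q).
Proof. by apply/path_classP; apply: concat_homotopic; exact: repr_path_class. Qed.

Lemma pi1_invE (p : loop) : pi1_inv (path_class p) = path_class (reverse p).
Proof. by apply/path_classP; apply: reverse_homotopic; exact: repr_path_class. Qed.

Lemma pi1_mulA : associative pi1_mul.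
Proof.
elim/pi1_ind => p; elim/pi1_ind => q; elim/pi1_ind => r; rewrite !pi1_mulE.
by apply/path_classP; apply: homotopic_sym; exact: concatA_homotopic.
Qed.

Lemma pi1_mul1 : left_id pi1_one pi1_mul.
Proof.
by elim/pi1_ind => p; rewrite pi1_mulE; apply/path_classP; exact: concat0_homotopic.
Qed.

Lemma pi1_mulr1 : right_id pi1_one pi1_mul.
Proof.
by elim/pi1_ind => p; rewrite pi1_mulE; apply/path_classP; exact: concat1_homotopic.
Qed.

Lemma pi1_mulV : right_inverse pi1_one pi1_inv pi1_mul.
Proof.
elim/pi1_ind => p; rewrite pi1_invE pi1_mulE; apply/path_classP.
exact: concatV_homotopic.
Qed.

Lemma pi1_mulVr : left_inverse pi1_one pi1_inv pi1_mul.
Proof.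
elim/pi1_ind => p; rewrite -{2}(reverseK p) -pi1_invE.
by rewrite (pi1_invE p) pi1_mulV.
Qed.

HB.instance Definition _ := isGroup.Build pi1
  pi1_mulA pi1_mul1 pi1_mulr1 pi1_mulVr pi1_mulV.

End FundamentalGroup.

Section GroupNotions.
Local Open Scope group_scope.

Definition torsion_free (G : groupType) : Prop :=
  forall (x : G) (n : nat), (0 < n)%N -> x ^+ n = 1 -> x = 1.

Definition group_center (G : groupType) : set G :=
  [set x | forall y : G, commute x y].

Definition cyclic_subgroup (G : groupType) (x : G) : set G :=
  [set y | exists n : nat, y = x ^+ n \/ y = x ^- n].

(* The letter [(i, false)] stands for the generator [i], [(i, true)] for its
   inverse. *)
Definition word (A : Type) : Type := seq (A * bool).

Definition positive_word (A : Type) (s : seq A) : word A :=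
  [seq (i, false) | i <- s].

(* Equality of words in the group with generators [A] and relations [u = v] for
   [rels u v]. *)
Inductive presented_eq (A : Type) (rels : word A -> word A -> Prop) :
    word A -> word A -> Prop :=
| presented_refl u : presented_eq rels u u
| presented_sym u v : presented_eq rels u v -> presented_eq rels v u
| presented_trans u v w :
    presented_eq rels u v -> presented_eq rels v w -> presented_eq rels u w
| presented_cat u u' v v' :
    presented_eq rels u u' -> presented_eq rels v v' ->
    presented_eq rels (u ++ v) (u' ++ v')
| presented_cancel i b : presented_eq rels [:: (i, b); (i, ~~ b)] [::]
| presented_rel u v : rels u v -> presented_eq rels u v.

Definition word_eval (A : Type) (G : groupType) (g : A -> G) (w : word A) : G :=
  \prod_(l <- w) (if l.2 then (g l.1)^-1 else g l.1).

(* The assignment [g] induces an isomorphism onto [G] from the group with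
   generators [A] and relations [rels]. *)
Definition is_presentation (A : Type) (rels : word A -> word A -> Prop)
    (G : groupType) (g : A -> G) : Prop :=
  (forall x : G, exists w, x = word_eval g w) /\
  (forall u v, word_eval g u = word_eval g v <-> presented_eq rels u v).

End GroupNotions.

Arguments group_center G : clear implicits.

Section QuasiBraids.
Context (R : realType).
Local Notation C := (R[i]^o).
Local Notation I := (unit_interval R).

(* [C] is [R[i]] with the topology of its norm (only the copy [R[i]^o] carries
   it); an ordered configuration is a vector [z] whose entries are the points. *)
Definition ordered_config : set 'rV[C]_3 :=
  [set z : 'rV[C]_3 | injective (z ord0) /\
    forall i j k : 'I_3, i != j -> j != k -> i != k ->
      z ord0 i + z ord0 j != 2 * z ord0 k].

(* Ordered configurations with the same underlying set of points. *)
Definition same_config (z w : set_type ordered_config) : bool :=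
  `[< range (set_val z ord0) = range (set_val w ord0) >].

Lemma same_config_equiv : equiv_class_of same_config.
Proof.
split=> [z|z w|z w u]; rewrite /same_config; first exact/asboolP.
  by apply: asbool_equiv_eq; split=> ->.
by move=> /asboolP zw /asboolP wu; apply/asboolP; rewrite -wu.
Qed.

Canonical config_equiv := EquivRelPack same_config_equiv.

Definition QC3 : Type := quotient_topology {eq_quot config_equiv}.

HB.instance Definition _ := Topological.on QC3.
HB.instance Definition _ := Quotient.on QC3.

Definition row3 (a b c : C) : 'rV[C]_3 := \row_(i < 3) [:: a; b; c]`_i.

Lemma row3_ordered_config (a b c : C) :
  uniq [:: a; b; c] -> a + b != 2 * c -> a + c != 2 * b -> b + c != 2 * a ->
  row3 a b c \in ordered_config.
Proof.
move=> abc_uniq abc acb bca; apply/mem_set; split.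
  move=> i j; rewrite !mxE => /eqP; rewrite nth_uniq// => /eqP.
  exact: val_inj.
case=> [[|[|[|//]]] /= hi] [[|[|[|//]]] /= hj] [[|[|[|//]]] /= hk] //.
all: by move=> _ _ _; rewrite !mxE //= addrC.
Qed.

Definition expi (x : R) : C := cos x +i* sin x.

Lemma expi_neq (x r : R) : r ^+ 2 != 1 -> expi x != r%:C.
Proof.
apply: contra_neq => -[cosr sinr].
by rewrite -(cos2Dsin2 x) cosr sinr expr0n addr0.
Qed.

Lemma range_row3 (a b c : C) :
  range (row3 a b c ord0) = [set x | x \in [:: a; b; c]].
Proof.
apply/seteqP; split => x /=.
  by case=> i _ <-; rewrite mxE mem_nth.
move=> /(nthP 0)[i i3 <-]; exists (Ordinal i3) => //.
by rewrite mxE.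
Qed.

Lemma complex_continuous (Z : topologicalType) (f g : Z -> R) :
  continuous f -> continuous g -> continuous (fun z => f z +i* g z : C).
Proof.
move=> cf cg z; apply/(@cvgrPdist_lt R[i] C) => e; rewrite ltcE => /andP[/eqP ei /= er].
have e2 : 0 < complex.Re e / 2 by rewrite divr_gt0.
have /cvgrPdist_lt/(_ _ e2) Hf := cf z.
have /cvgrPdist_lt/(_ _ e2) Hg := cg z.
near=> t.
have ft : `|f z - f t| < complex.Re e / 2 by near: t.
have gt : `|g z - g t| < complex.Re e / 2 by near: t.
rewrite normc_def ltcE /= ei eqxx /=.
apply: le_lt_trans (_ : `|f z - f t| + `|g z - g t| < _); last by lra.
rewrite -[leRHS]ger0_norm ?addr_ge0// -sqrtr_sqr ler_wsqrtr//.
rewrite [leRHS]sqrrD !real_normK ?num_real// lerD2r lerDl.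
by rewrite mulrn_wge0// mulr_ge0.
Unshelve. all: by end_near. Qed.

Lemma row3_continuous (Z : topologicalType) (a b c : Z -> C) :
  continuous a -> continuous b -> continuous c ->
  continuous (fun z => row3 (a z) (b z) (c z)).
Proof.
move=> ca cb cc z A [P hP PA].
apply: (filterS (P := fun t => forall i j, P i j (row3 (a t) (b t) (c t) i j))).
  by move=> t ht; exact: PA.
apply: filter_forall => i; apply: filter_forall => -[[|[|[|//]]] hj].
all: have := hP i (Ordinal hj); rewrite !mxE /= => h.
all: by near=> t; rewrite mxE /=; near: t; first [exact: (ca _ _ h)|exact: (cb _ _ h)|exact: (cc _ _ h)].
Unshelve. all: by end_near. Qed.

(* [exp (pi * 'i * t)] *)
Definition turn (t : I) : C := expi (pi * set_val t).

Lemma turn_continuous : continuous turn.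
Proof.
have cpi : continuous (fun t : I => pi * set_val t : R).
  by apply: ctsM; [exact: cts_cst|exact: val_continuous].
apply: complex_continuous.
  exact: cts_comp cpi (@continuous_cos R).
exact: cts_comp cpi (@continuous_sin R).
Qed.

Lemma turn_zero : turn zero = 1.
Proof. by rewrite /turn val_zero mulr0 /expi cos0 sin0. Qed.

Lemma turn_one : turn one = -1.
Proof. by rewrite /turn val_one mulr1 /expi cospi sinpi; apply/eqP; rewrite eq_complex /= oppr0 !eqxx. Qed.

Lemma affine_turn_continuous (k l : C) : continuous (fun t => k + l * turn t).
Proof.
move=> t; apply: (@cvgD R[i] C I (nbhs t) _ (cst k) (fun t => l * turn t) k (l * turn t)).
  exact: cst_continuous.
apply: (@cvgM R[i] I (nbhs t) _ (cst l) turn l (turn t)).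
  exact: cst_continuous.
exact: turn_continuous.
Qed.

Lemma normr_turn (t : I) : `|turn t| = 1 :> R[i].
Proof. by rewrite normc_def /= cos2Dsin2 sqrtr1. Qed.

Lemma turn_neq (t : I) (m n : nat) (k A B : R[i]) : k != 0 -> m != n ->
  A - B = k * (m%:R * turn t - n%:R) \/ A - B = k * (m%:R * turn t + n%:R) ->
  A != B.
Proof.
move=> k0 mn AB; rewrite -subr_eq0.
have tE (z : R[i]) : `|z| = n%:R -> m%:R * turn t - z != 0.
  move=> zn; rewrite subr_eq0; apply: contra_neq mn => /(congr1 Num.norm).
  rewrite normrM normr_turn mulr1 zn normr_nat => /eqP.
  by rewrite eqr_nat => /eqP.
case: AB => ->; rewrite mulf_neq0//; first by rewrite tE// normr_nat.
by rewrite -[n%:R]opprK tE// normrN normr_nat.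
Qed.

Lemma base_subproof : row3 0 1 3 \in ordered_config.
Proof.
have natE (A B : C) (m n : nat) : A = m%:R -> B = n%:R -> m != n -> A != B.
  by move=> -> ->; rewrite (@eqr_nat R[i]).
apply: row3_ordered_config; last 1 first.
- by apply: (natE _ _ 4 0) => //; rewrite ?mulr0// -natrD.
- rewrite /= !inE !negb_or (natE 0 1 0 1)//= (natE 0 3 0 3)//=.
  by rewrite (natE 1 3 1 3).
- by apply: (natE _ _ 1 6) => //; rewrite ?add0r// -natrM.
- by apply: (natE _ _ 3 2) => //; rewrite ?add0r// mulr1.
Qed.

Definition base_config : set_type ordered_config :=
  exist _ (row3 0 1 3) base_subproof.

Definition gamma1_row (t : I) : 'rV[C]_3 :=
  row3 (2^-1 - 2^-1 * turn t) (2^-1 + 2^-1 * turn t) 3.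

Definition gamma2_row (t : I) : 'rV[C]_3 := row3 0 (2 - turn t) (2 + turn t).

Lemma gamma1_subproof (t : I) : gamma1_row t \in ordered_config.
Proof.
have n0 n : n.+1%:R != 0 :> R[i] by rewrite pnatr_eq0.
have h0 : 2^-1 != 0 :> R[i] by rewrite invr_eq0 n0.
have neqL m n (k A B : R[i]) : k != 0 -> m != n ->
  A - B = k * (m%:R * turn t - n%:R) -> A != B.
  by move=> k0 mn AB; exact: (turn_neq k0 mn (or_introl AB)).
have neqR m n (k A B : R[i]) : k != 0 -> m != n ->
  A - B = k * (m%:R * turn t + n%:R) -> A != B.
  by move=> k0 mn AB; exact: (turn_neq k0 mn (or_intror AB)).
rewrite /gamma1_row.
move: (turn t : R[i]) neqL neqR => e neqL neqR.
apply: row3_ordered_config => /=; rewrite ?inE ?negb_or; first (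
  apply/andP; split; [apply/andP; split|apply/andP; split=> //]).
- by apply: (neqR 1 0 (-1)) ; rewrite ?oppr_eq0 ?oner_eq0 ?pnatr_eq0//; field.
- by apply: (neqR 1 5 (- 2^-1)) ; rewrite ?oppr_eq0 ?oner_eq0 ?pnatr_eq0//; field.
- by apply: (neqL 1 5 2^-1); rewrite ?oner_eq0 ?pnatr_eq0//; field.
- by apply: (neqR 0 1 (-5)) ; rewrite ?oppr_eq0 ?oner_eq0 ?pnatr_eq0//; field.
- by apply: (neqL 3 5 (- 2^-1)) ; rewrite ?oppr_eq0 ?oner_eq0 ?pnatr_eq0//; field.
- by apply: (neqR 3 5 2^-1); rewrite ?oner_eq0 ?pnatr_eq0//; field.
Qed.

Lemma gamma2_subproof (t : I) : gamma2_row t \in ordered_config.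
Proof.
have n0 n : n.+1%:R != 0 :> R[i] by rewrite pnatr_eq0.
have neqL m n (k A B : R[i]) : k != 0 -> m != n ->
  A - B = k * (m%:R * turn t - n%:R) -> A != B.
  by move=> k0 mn AB; exact: (turn_neq k0 mn (or_introl AB)).
have neqR m n (k A B : R[i]) : k != 0 -> m != n ->
  A - B = k * (m%:R * turn t + n%:R) -> A != B.
  by move=> k0 mn AB; exact: (turn_neq k0 mn (or_intror AB)).
rewrite /gamma2_row.
move: (turn t : R[i]) neqL neqR => e neqL neqR.
apply: row3_ordered_config => /=; rewrite ?inE ?negb_or; first (
  apply/andP; split; [apply/andP; split|apply/andP; split=> //]).
- by apply: (neqL 1 2 1); rewrite ?oner_eq0 ?pnatr_eq0//; ring.
- by apply: (neqR 1 2 (-1)) ; rewrite ?oppr_eq0 ?oner_eq0 ?pnatr_eq0//; ring.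
- by apply: (neqR 1 0 (-2)) ; rewrite ?oppr_eq0 ?oner_eq0 ?pnatr_eq0//; ring.
- by apply: (neqR 3 2 (-1)) ; rewrite ?oppr_eq0 ?oner_eq0 ?pnatr_eq0//; ring.
- by apply: (neqL 3 2 1); rewrite ?oner_eq0 ?pnatr_eq0//; ring.
- by apply: (neqR 0 1 4); rewrite ?oner_eq0 ?pnatr_eq0//; ring.
Qed.

Definition gamma1_config (t : I) : set_type ordered_config :=
  exist _ (gamma1_row t) (gamma1_subproof t).

Definition gamma2_config (t : I) : set_type ordered_config :=
  exist _ (gamma2_row t) (gamma2_subproof t).

Definition base_point : QC3 := \pi_QC3 base_config.

Definition gamma1_fun (t : I) : QC3 := \pi_QC3 (gamma1_config t).

Definition gamma2_fun (t : I) : QC3 := \pi_QC3 (gamma2_config t).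

Lemma config_continuous (Z : topologicalType) (f : Z -> set_type ordered_config) :
  continuous (fun z => set_val (f z)) -> continuous (fun z => \pi_QC3 (f z)).
Proof.
move=> cf; apply: (cts_comp (g := f)) pi_continuous.
exact: continuous_comp_initial.
Qed.

Lemma gamma1_continuous : continuous gamma1_fun.
Proof.
apply: config_continuous; rewrite /= /gamma1_row.
apply: row3_continuous; last exact: cts_cst.
  rewrite (_ : (fun t => _) = fun t => 2^-1 + (- 2^-1) * turn t).
    exact: affine_turn_continuous.
  by apply/funext => t; rewrite mulNr.
exact: affine_turn_continuous.
Qed.

Lemma gamma2_continuous : continuous gamma2_fun.
Proof.
apply: config_continuous; rewrite /= /gamma2_row.
apply: row3_continuous; first exact: cts_cst.
  rewrite (_ : (fun t => _) = fun t => 2 + (- 1) * turn t).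
    exact: affine_turn_continuous.
  by apply/funext => t; rewrite mulN1r.
rewrite (_ : (fun t => _) = fun t => 2 + 1 * turn t).
  exact: affine_turn_continuous.
by apply/funext => t; rewrite mul1r.
Qed.

Lemma same_configP (z w : set_type ordered_config) :
  range (set_val z ord0) = range (set_val w ord0) ->
  \pi_QC3 z = \pi_QC3 w.
Proof.
move=> zw; apply/(@eqquotP _ _ {eq_quot config_equiv} z w).
exact/asboolP.
Qed.

Lemma perm_row3 (a b c a' b' c' : C) :
  perm_eq [:: a; b; c] [:: a'; b'; c'] ->
  range (row3 a b c ord0) = range (row3 a' b' c' ord0).
Proof.
by move=> abc; rewrite !range_row3; apply/seteqP; split => x;
  rewrite /= (perm_mem abc).
Qed.

Lemma gamma1_zero : gamma1_fun zero = base_point.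
Proof.
apply: same_configP; apply: perm_row3; rewrite turn_zero mulr1 subrr.
by rewrite (_ : 2^-1 + 2^-1 = 1 :> R[i])//; field.
Qed.

Lemma gamma1_one : gamma1_fun one = base_point.
Proof.
apply: same_configP; apply: perm_row3; rewrite turn_one mulrN1 subrr opprK.
rewrite (_ : 2^-1 + 2^-1 = 1 :> R[i]); last by field.
exact: (permEl (perm_catCA [:: 1 : C] [:: 0] [:: 3])).
Qed.

Lemma gamma2_zero : gamma2_fun zero = base_point.
Proof.
apply: same_configP; apply: perm_row3; rewrite turn_zero.
rewrite (_ : 2 - 1 = 1 :> R[i]); last by ring.
by rewrite (_ : 2 + 1 = 3 :> R[i])//; ring.
Qed.

Lemma gamma2_one : gamma2_fun one = base_point.
Proof.
apply: same_configP; apply: perm_row3; rewrite turn_one opprK.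
rewrite (_ : 2 - 1 = 1 :> R[i]); last by ring.
rewrite (_ : 2 + 1 = 3 :> R[i]); last by ring.
by rewrite perm_cons; exact: (permEl (perm_catC [:: 3 : C] [:: 1])).
Qed.

Definition gamma1_loop : {path I from base_point to base_point} :=
  mk_path gamma1_continuous gamma1_zero gamma1_one.

Definition gamma2_loop : {path I from base_point to base_point} :=
  mk_path gamma2_continuous gamma2_zero gamma2_one.

Definition QB3 : groupType := pi1 R base_point.

Definition gamma1 : QB3 := path_class gamma1_loop.

Definition gamma2 : QB3 := path_class gamma2_loop.

Definition Delta : QB3 :=
  (gamma1 * gamma2 * gamma1 * gamma2 * gamma1 * gamma2)%g.

End QuasiBraids.

Definition QB3_gen (R : realType) (b : bool) : QB3 R :=
  if b then gamma2 R else gamma1 R.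

Definition QB3_rels (u v : word bool) : Prop :=
  u = positive_word [:: false; true; false; true; false; true] /\
  v = positive_word [:: true; false; true; false; true; false].

(* Main.v *)
Require Import Defs.
From mathcomp Require Import all_boot all_algebra.
From mathcomp Require Import all_classical reals topology.
From mathcomp Require Import zify.

(* Put c = gamma1 gamma2 and b = gamma2: the relation says exactly that c^3
   commutes with b. Hence the group is the semidirect product of the free group
   on b_i = c^i b c^-i (i mod 3) by the infinite cyclic group of c, which
   permutes the b_i cyclically. The free group is torsion free, and an element
   E(s) c^p, with s a reduced word, can commute with c only if s is invariant
   under the fixed-point free shift of letters, so s is empty, and with b only
   if 3 divides p. Freeness of the b_i comes from an action of the group on
   pairs (reduced word, integer). *)

Set Implicit Arguments.
Unset Strict Implicit.
Unset Printing Implicit Defensive.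

Import GRing.Theory.

(** * Reduced words and torsion in free groups *)

Section ReducedWords.
Context {A : eqType}.
Implicit Types (l : A * bool) (s : word A).

Definition letter_inv l : A * bool := (l.1, ~~ l.2).

Definition composable l l' : bool := l' != letter_inv l.

Definition reduced s : bool := sorted composable s.

(** Left multiplication by a letter in the free group, computed on reduced words. *)
Definition push l s : word A :=
  if s is l' :: s' then if l' == letter_inv l then s' else l :: s else [:: l].

Lemma letter_invK : involutive letter_inv.
Proof. by case=> i e; rewrite /letter_inv /= negbK. Qed.

Lemma push_reduced l s : reduced s -> reduced (push l s).
Proof.
case: s => [|l' s] //= sr; case: eqP => [_|/eqP ll']; first exact: path_sorted sr.
by rewrite /= /composable ll'.
Qed.

Lemma push_cons l s : reduced (l :: s) -> push l s = l :: s.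
Proof. by case: s => //= l' s /andP[/negPf ->]. Qed.

Lemma foldr_push s : reduced s -> foldr push [::] s = s.
Proof.
by elim: s => //= l s IH ls; rewrite IH ?push_cons//; exact: path_sorted ls.
Qed.

Lemma pushK l s : reduced s -> push l (push (letter_inv l) s) = s.
Proof.
case: s => [|l' s] /=; first by rewrite eqxx.
rewrite letter_invK; case: eqP => [->|_ _]; last by rewrite /= eqxx.
exact: push_cons.
Qed.

Local Open Scope group_scope.

Lemma word_eval_nil (G : groupType) (g : A -> G) : word_eval g [::] = 1.
Proof. exact: big_nil. Qed.

Lemma word_eval_cons (G : groupType) (g : A -> G) l s :
  word_eval g (l :: s) = (if l.2 then (g l.1)^-1 else g l.1) * word_eval g s.
Proof. exact: big_cons. Qed.

Lemma word_eval_cat (G : groupType) (g : A -> G) s t :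
  word_eval g (s ++ t) = word_eval g s * word_eval g t.
Proof. exact: big_cat. Qed.

Lemma word_eval_push (G : groupType) (g : A -> G) l s :
  word_eval g (push l s) = (if l.2 then (g l.1)^-1 else g l.1) * word_eval g s.
Proof.
case: s => [|l' s] /=; first by rewrite word_eval_cons.
case: eqP => [->|_]; rewrite !word_eval_cons //=.
by case: l.2; rewrite /= ?mulKg ?mulVKg.
Qed.

Lemma word_eval_nseq (G : groupType) (g : A -> G) n s :
  word_eval g (flatten (nseq n s)) = word_eval g s ^+ n.
Proof.
elim: n => [|n IH]; first by rewrite /= word_eval_nil.
by rewrite /= word_eval_cat IH expgS.
Qed.

(** Starting the path at the last letter also checks the junction between copies: the word is
    cyclically reduced. *)
Lemma nseq_reduced n l s :
  path composable (last l s) (l :: s) -> reduced (flatten (nseq n (l :: s))).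
Proof.
move=> ls.
suff: path composable (last l s) (flatten (nseq n (l :: s))) by exact: path_sorted.
by elim: n => //= n IH; move: ls; rewrite cat_path /= => /andP[-> ->].
Qed.

(** Induction on length: powers of a cyclically reduced word are reduced, so freeness applies; any
    other word is conjugate to a shorter one. *)
Lemma free_torsion_free (G : groupType) (g : A -> G) :
  (forall s, reduced s -> word_eval g s = 1 -> s = [::]) ->
  forall n s, (0 < n)%N -> reduced s -> word_eval g s ^+ n = 1 -> s = [::].
Proof.
move=> free n s n0; have [k] := ubnP (size s).
elim: k s => // k IH [|l s] // sk sr sn.
have [ls|] := boolP (composable (last l s) l).
  have ls' : path composable (last l s) (l :: s) by rewrite /= ls.
  have := free _ (nseq_reduced n ls').
  by rewrite word_eval_nseq => /(_ sn); case: (n) n0.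
rewrite negbK => /eqP lE.
case/lastP: s => [|s l'] in sk sr sn lE *.
  by case: l lE {sk sr sn} => i [].
move: lE; rewrite last_rcons => lE; move: sk sr sn; rewrite {}lE.
rewrite /= size_rcons => sk sr sn.
(* The word is now [letter_inv l'], [s], [l']: its core [s] is shorter and, being conjugate to it,
   has the same [n]-th power 1. *)
have s0 : s = [::].
  apply: IH; first by lia.
    have : path composable (letter_inv l') (rcons s l') := sr.
    by rewrite rcons_path => /andP[/path_sorted].
  apply/eqP; rewrite -(conjg_eq1 _ (word_eval g [:: l'])) conjXg; apply/eqP.
  rewrite -[RHS]sn; congr (_ ^+ n).
  rewrite -cats1 -cat_cons word_eval_cat conjgE !word_eval_cons word_eval_nil.
  by case: l' {sr sn} => i [] /=; rewrite mulg1 ?invgK !mulgA.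
by have := sr; rewrite s0 /= /composable letter_invK eqxx.
Qed.

End ReducedWords.

(** The domain [D] will be the states with reduced word, where inverse letters do act as inverse
    maps. *)
Lemma presented_action (A T : Type) (rels : word A -> word A -> Prop)
    (D : T -> Prop) (f : A * bool -> T -> T) :
  (forall l t, D t -> D (f l t)) ->
  (forall i e t, D t -> f (i, e) (f (i, ~~ e) t) = t) ->
  (forall u v, rels u v -> forall t, D t -> foldr f t u = foldr f t v) ->
  forall u v, presented_eq rels u v ->
  forall t, D t -> foldr f t u = foldr f t v.
Proof.
move=> Df fK frel u v; elim=> {u v} //.
- by move=> u v _ IH t Dt; rewrite IH.
- by move=> u v w _ IHu _ IHv t Dt; rewrite IHu// IHv.
- move=> u u' v v' _ IHu _ IHv t Dt; rewrite !foldr_cat IHv// IHu//.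
  by elim: v' {IHu IHv} => //= l v' IH; exact: Df.
Qed.

(** * Action of the generators on pairs (reduced word, integer) *)

Section Shift.
Local Open Scope ring_scope.
Implicit Types (l : 'Z_3 * bool) (s : word 'Z_3).

(** Models conjugation by [c^k], which sends [b_i] to [b_(i+k)]. *)
Definition shift_letter (k : 'Z_3) l : 'Z_3 * bool := (l.1 + k, l.2).

Definition shift k s : word 'Z_3 := map (shift_letter k) s.

Lemma shift_letter_inj k : injective (shift_letter k).
Proof. by move=> [i e] [j e'] /pair_equal_spec[/addIr /= -> /= ->]. Qed.

Lemma shift_push k l s : shift k (push l s) = push (shift_letter k l) (shift k s).
Proof.
case: s => [|l' s] //=.
rewrite -[letter_inv (shift_letter k l)]/(shift_letter k (letter_inv l)).
by rewrite (inj_eq (@shift_letter_inj k)); case: ifP.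
Qed.

Lemma shift_reduced k s : reduced (shift k s) = reduced s.
Proof.
rewrite /reduced sorted_map; apply: eq_sorted => l l' /=.
rewrite /composable -[letter_inv (shift_letter k l)]/(shift_letter k (letter_inv l)).
by rewrite (inj_eq (@shift_letter_inj k)).
Qed.

Lemma shiftD j k s : shift j (shift k s) = shift (k + j) s.
Proof. by rewrite /shift -map_comp; apply: eq_map => l /=; rewrite /shift_letter /= addrA. Qed.

Lemma shift0 s : shift 0 s = s.
Proof. by apply: map_id_in => -[i e] _; rewrite /shift_letter /= addr0. Qed.

(** A pair [(s, m)] stands for the element [s c^m] of the semidirect product; generators act by left
    multiplication. *)
Definition state : Type := (word 'Z_3 * int)%type.

(* The generators are gamma2 = b and gamma1 = c b^-1. *)
Definition step (l : bool * bool) (t : state) : state :=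
  match l with
  | (true, e) => (push (0, e) t.1, t.2)
  | (false, false) => (shift 1 (push (0, true) t.1), t.2 + 1)
  | (false, true) => (push (0, false) (shift (-1) t.1), t.2 - 1)
  end.

Lemma step_reduced (l : bool * bool) (t : state) : reduced t.1 -> reduced (step l t).1.
Proof.
by case: l t => [[] e] [s m] /= sr; [|case: e];
  rewrite /= ?shift_reduced; rewrite ?push_reduced ?shift_reduced.
Qed.

Lemma stepK i e (t : state) : reduced t.1 -> step (i, e) (step (i, ~~ e) t) = t.
Proof.
case: t => s m /= sr; case: i => /=.
  by rewrite -[(0, ~~ e)]/(letter_inv (0, e)) pushK.
case: e => /=.
  by rewrite shiftD subrr shift0 (pushK (0, false))// addrK.
by rewrite (pushK (0, true)) ?shift_reduced// shiftD addNr shift0 subrK.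
Qed.

Lemma step_product s m : reduced s ->
  step (false, false) (step (true, false) (s, m)) = (shift 1 s, m + 1).
Proof. by move=> sr; rewrite /= (pushK (0, true)). Qed.

Lemma shift3 s : shift 1 (shift 1 (shift 1 s)) = s.
Proof. by rewrite !shiftD -[RHS]shift0; congr (shift _ s); apply: val_inj. Qed.

Lemma step_rels u v : QB3_rels u v ->
  forall t : state, reduced t.1 -> foldr step t u = foldr step t v.
Proof.
case=> -> -> [s m] sr.
have aE : step (false, false) (s, m) = (shift 1 (push (0, true) s), m + 1) by [].
have bE r k : step (true, false) (r, k) = (push (0, false) r, k) by [].
have abE r k := @step_product r k.
(* Abstracting [step] prevents its unfolding, so that each product [a b] is rewritten as one shift;
   three shifts cancel. *)
move: step aE bE abE => f /=; move: (f (false, false)) (f (true, false)) => a b aE bE abE.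
by rewrite aE !abE ?bE ?shift3 ?(pushK (0, false)) ?shift_reduced ?push_reduced.
Qed.

End Shift.

(** * Normal form in a group with this presentation *)

Section Presented.
Context (G : groupType) (g : bool -> G) (presG : is_presentation QB3_rels g).
Implicit Types (l : 'Z_3 * bool) (s : word 'Z_3).
Local Open Scope group_scope.

Local Notation a := (g false).
Local Notation b := (g true).
Local Notation c := (a * b).

Definition conj_gen (i : 'Z_3) : G := c ^+ i * b * c ^- i.

Local Notation E := (word_eval conj_gen).

Lemma product_cube : (a * b * a * b * a * b) = c ^+ 3.
Proof. by rewrite !expgS expg0 mulg1 !mulgA. Qed.

Lemma cube_commute_gen : commute (c ^+ 3) b.
Proof.
have := (presG.2 (positive_word [:: false; true; false; true; false; true])
  (positive_word [:: true; false; true; false; true; false])).2.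
move=> /(_ (presented_rel (conj erefl erefl))).
rewrite /positive_word /= !word_eval_cons !word_eval_nil /= !mulg1 !mulgA => ab.
by rewrite /commute -product_cube {1}ab !mulgA.
Qed.

Lemma cube_central x : commute (c ^+ 3) x.
Proof.
have [w ->] := presG.1 x; elim: w => [|[i e] w IH].
  by rewrite word_eval_nil; exact: commute1.
rewrite word_eval_cons; apply: commuteM IH => /=.
have cb := cube_commute_gen.
have ca : commute (c ^+ 3) a.
  (* Here [a] is written as [c b^-1]. *)
  rewrite -[X in commute _ X](mulgK b a); apply: commuteM (commuteV cb).
  by apply/commute_sym/commuteX.
by case: e; case: i; rewrite /=; try apply: commuteV.
Qed.

Lemma conj_gen0 : conj_gen 0%R = b.
Proof. by rewrite /conj_gen /= invg1 mulg1 mul1g. Qed.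

(** When the index wraps from 2 to 0, the exponent drops by 3, which the centrality of [c^3]
    absorbs. *)
Lemma conj_gen_shift i : c * conj_gen i = conj_gen (i + 1)%R * c.
Proof.
have [m im] : exists m, (i.+1 = m * 3 + (i + 1)%R :> nat)%N.
  by exists (i.+1 %/ 3)%N; rewrite [LHS](divn_eq _ 3) /= addn1.
have cc k : commute (c ^+ (k * 3)) b.
  by rewrite mulnC expgnA; apply/commute_sym/commuteX/commute_sym/cube_central.
rewrite /conj_gen; move: c cc => x cc.
apply: (mulIg (x ^+ i)); rewrite -!mulgA mulVg mulg1 -expgS.
by rewrite [LHS]mulgA -expgS im addnC expgnDr mulKg -[LHS]mulgA cc.
Qed.

Lemma word_eval_shift s : c * E s = E (shift 1%R s) * c.
Proof.
elim: s => [|[i e] s IH]; first by rewrite /= !word_eval_nil mulg1 mul1g.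
rewrite /= !word_eval_cons -[RHS]mulgA -IH ![_ * (_ * E s)]mulgA; congr (_ * _) => /=.
case: e; last exact: conj_gen_shift.
by apply: (mulgI (conj_gen (i + 1)%R)); rewrite mulgA -conj_gen_shift mulgK mulVKg.
Qed.

Lemma word_eval_shift_exp p s : c ^+ p * E s = E (shift p%:R%R s) * c ^+ p.
Proof.
elim: p => [|p IH]; first by rewrite shift0 mulg1 mul1g.
by rewrite !expgS -mulgA IH mulgA word_eval_shift shiftD natr1 -mulgA.
Qed.

(** The central factor [c^(3q)] keeps every exponent of [c] a natural number. *)
Lemma normal_form x : exists q s p, reduced s /\ x * c ^+ 3 ^+ q = E s * c ^+ p.
Proof.
have [w ->] := presG.1 x; elim: w => [|[i e] w [q [s [p [sr IH]]]]].
  by exists 0, [::], 0; rewrite !word_eval_nil !expg0.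
have mulb f r k z q' : reduced r -> z * c ^+ 3 ^+ q' = E r * c ^+ k ->
  reduced (push (0%R, f) r) /\
  (if f then b^-1 else b) * z * c ^+ 3 ^+ q' = E (push (0%R, f) r) * c ^+ k.
  move=> rr zE; split; first exact: push_reduced.
  by rewrite word_eval_push /= conj_gen0 -mulgA zE mulgA.
have mulc r k z q' : reduced r -> z * c ^+ 3 ^+ q' = E r * c ^+ k ->
  reduced (shift 1%R r) /\ c * z * c ^+ 3 ^+ q' = E (shift 1%R r) * c ^+ k.+1.
  move=> rr zE; split; first by rewrite shift_reduced.
  by rewrite -mulgA zE mulgA word_eval_shift -mulgA -expgS.
rewrite word_eval_cons; move: (word_eval g w) IH => y IH.
case: i; first by exists q, (push (0%R, e) s), p; exact: mulb.
case: e => /=.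
  have [sr1 IH1] := mulc _ _ _ _ sr IH.
  have [sr2 IH2] := mulc _ _ _ _ sr1 IH1.
  have [sr3 IH3] := mulb false _ _ _ _ sr2 IH2.
  exists q.+1, (push (0%R, false) (shift 1%R (shift 1%R s))), p.+2; split=> //.
  (* One more central cube turns [a^-1 = b c^-1] into a product without inverses. *)
  have ac : a^-1 * c ^+ 3 = b * c * c by rewrite -product_cube !mulgA mulVg mul1g.
  rewrite -IH3 /= (expgS (c ^+ 3)) [LHS]mulgA -(mulgA _ y) -(cube_central y).
  by rewrite (mulgA a^-1) ac !mulgA.
have [sr1 IH1] := mulb true _ _ _ _ sr IH.
have [sr2 IH2] := mulc _ _ _ _ sr1 IH1.
exists q, (shift 1%R (push (0%R, true) s)), p.+1; split=> //.
by rewrite -IH2 /= !mulgA mulgK.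
Qed.

(** * The action of the group and freeness of the [b_i] *)

(** Uses a chosen word for [x]; on reduced states [act_word] makes the choice irrelevant. *)
Definition act (x : G) (t : state) : state :=
  foldr step t (sval (cid (presG.1 x))).

Lemma act_word w t : reduced t.1 -> act (word_eval g w) t = foldr step t w.
Proof.
rewrite /act; case: cid => v /= /presG.2 wv tr; apply/esym.
exact: (presented_action step_reduced stepK step_rels wv).
Qed.

Lemma act_reduced x t : reduced t.1 -> reduced (act x t).1.
Proof. by rewrite /act; elim: (sval _) => //= l w IH /IH; exact: step_reduced. Qed.

Lemma actM x y t : reduced t.1 -> act (x * y) t = act x (act y t).
Proof.
have [w ->] := presG.1 x; have [v ->] := presG.1 y => tr.
rewrite -word_eval_cat (act_word (w ++ v))// foldr_cat -(act_word v)//.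
by rewrite -act_word// act_reduced.
Qed.

Lemma act1 t : reduced t.1 -> act 1 t = t.
Proof. by move=> tr; rewrite -(word_eval_nil g) act_word. Qed.

Lemma act_gen i t : reduced t.1 -> act (g i) t = step (i, false) t.
Proof.
by move=> tr; rewrite -[g i]mulg1 -(word_eval_nil g)
  -(word_eval_cons g (i, false)) act_word.
Qed.

Lemma act_product s m : reduced s -> act c (s, m) = (shift 1%R s, (m + 1)%R).
Proof.
by move=> sr; rewrite actM// (act_gen true)// act_gen ?step_product//= push_reduced.
Qed.

Lemma act_product_exp p m : act (c ^+ p) ([::], m) = ([::], (m + p%:Z)%R).
Proof.
elim: p => [|p IH]; first by rewrite act1// addr0.
by rewrite expgS (actM c)// IH act_product//= -addrA -natz natr1 natz.
Qed.

Lemma act_conj_gen i s m : reduced s ->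
  act (conj_gen i) (s, m) = (push (i, false) s, m).
Proof.
have act0 r k : reduced r -> act (conj_gen 0%R) (r, k) = (push (0%R, false) r, k).
  by move=> rr; rewrite conj_gen0 act_gen.
have actS j : (forall r k, reduced r ->
    act (conj_gen j) (r, k) = (push (j, false) r, k)) ->
  forall r k, reduced r ->
    act (conj_gen (j + 1)%R) (r, k) = (push ((j + 1)%R, false) r, k).
  move=> actj r k rr; rewrite -[conj_gen (j + 1)%R](mulgK c) -conj_gen_shift.
  rewrite (actM (c * _))// (actM c) ?act_reduced//.
  (* The action of [c^-1] is never computed: it suffices that [c] sends its result [(r', k')] back
     to [(r, k)]. *)
  have := act_reduced c^-1 (rr : reduced (r, k).1).
  have : act c (act c^-1 (r, k)) = (r, k) by rewrite -(actM c)// mulgV act1.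
  case: (act c^-1 _) => r' k' + r'r; rewrite act_product// => -[<- <-].
  by rewrite actj// act_product ?push_reduced// shift_push.
have i3 : i = (val i)%:R%R by rewrite natr_Zp.
move: s m; rewrite {}i3; elim: (val i) => [|n IH] s m sr; first exact: act0.
by rewrite -natr1; exact: actS.
Qed.

Lemma act_word_conj_gen s t : reduced t.1 -> act (E s) t = (foldr push t.1 s, t.2).
Proof.
case: t => t m tr; elim: s => [|[i e] s IH]; first by rewrite word_eval_nil act1.
rewrite word_eval_cons actM// IH /=.
have sr : reduced (foldr push t s).
  by elim: (s) => //= l s' IH'; exact: push_reduced.
case: e; last by rewrite act_conj_gen.
rewrite -[in LHS](pushK (i, false) sr) -act_conj_gen ?push_reduced//.
by rewrite -actM ?push_reduced// mulVg act1 ?push_reduced.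
Qed.

Lemma act_product_exp_snd p t : reduced t.1 -> (act (c ^+ p) t).2 = (t.2 + p%:Z)%R.
Proof.
move=> tr; elim: p => [|p IH]; first by rewrite act1// addr0.
rewrite expgS (actM c)//; have := act_reduced (c ^+ p) tr.
case: (act _ _) IH => r m /= -> rr.
by rewrite act_product//= -addrA -natz natr1 natz.
Qed.

(** Acting on the empty word reads off [s] and [p], hence uniqueness of the normal form. *)
Lemma act_normal_form s p m : reduced s ->
  act (E s * c ^+ p) ([::], m) = (s, (m + p%:Z)%R).
Proof.
by move=> sr; rewrite actM// act_product_exp// act_word_conj_gen//= foldr_push.
Qed.

Lemma act_normal_form_exp_snd s p n :
  (act ((E s * c ^+ p) ^+ n) ([::], 0%R)).2 = ((n * p)%N%:Z)%R.
Proof.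
elim: n => [|n IH]; first by rewrite expg0 act1.
rewrite expgS actM// actM ?act_reduced// act_word_conj_gen ?act_reduced//=.
by rewrite act_product_exp_snd ?act_reduced// IH mulSn addnC PoszD.
Qed.

Lemma conj_gen_free s : reduced s -> E s = 1 -> s = [::].
Proof.
move=> sr s1; have := act_normal_form 0 0%R sr.
by rewrite s1 mul1g act1// => -[].
Qed.

(** * Torsion and center *)

(** If [x^n = 1], comparing integer components of [(x c^(3q))^n] gives [p = 3q], so [x = E s] lies
    in the free group. *)
Lemma presented_torsion_free : torsion_free G.
Proof.
move=> x n n0 xn; have [q [s [p [sr xE]]]] := normal_form x.
have comm_x : commute x (c ^+ 3 ^+ q) by apply/commuteX/commute_sym/cube_central.
have : (x * c ^+ 3 ^+ q) ^+ n = c ^+ (n * (3 * q)).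
  by rewrite expgMn// xn mul1g -!expgnA; congr (_ ^+ _); lia.
rewrite {1}xE => En.
have := act_normal_form_exp_snd s p n.
rewrite En act_product_exp add0r /= => -[/eqP].
rewrite eqn_pmul2l// => /eqP pE.
have {}xE : x = E s by apply: (mulIg (c ^+ 3 ^+ q)); rewrite xE -pE expgnA.
by rewrite xE (free_torsion_free conj_gen_free n0 sr) ?word_eval_nil// -xE.
Qed.

Lemma presented_center : group_center G = cyclic_subgroup (c ^+ 3).
Proof.
apply/seteqP; split=> x /=; last first.
  case=> n [->|->] y; apply/commute_sym; last apply: commuteV.
    by apply/commuteX/commute_sym/cube_central.
  by apply/commuteX/commute_sym/cube_central.
move=> xC; have [q [s [p [sr xE]]]] := normal_form x.
(* The normal form differs from [x] by a central factor, so it is central too. *)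
have : forall y, commute (E s * c ^+ p) y.
  move=> y; rewrite -xE; apply/commute_sym/commuteM; first exact/commute_sym.
  by apply/commuteX/commute_sym/cube_central.
move=> yC.
(* Commuting with [c] gives [s = shift 1 s]; a first letter of index [i] would satisfy [i = i + 1]
   modulo 3. *)
have s0 : s = [::].
  have /(congr1 (act^~ ([::], 0%R))) := yC c.
  rewrite (actM c)// act_normal_form// act_product//.
  rewrite (actM _ c)// (act_product (s := [::]))// act_normal_form//.
  case: s {sr xE yC} => [|[i e] s] // /(congr1 (fun t => (head (i, e) t.1).1)) /eqP.
  by rewrite /= -subr_eq0 opprD addrA subrr.
(* Commuting with [b_0] gives [b_p = b_0], and comparing letters shows that 3 divides [p]. *)
have := yC (E [:: (0%R, false)]).
rewrite s0 word_eval_nil mul1g /commute word_eval_shift_exp.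
move=> /(congr1 (act^~ ([::], 0%R))); rewrite !act_normal_form//.
move=> /(congr1 (fun t => (head (0%R, false) t.1).1)) /=.
rewrite add0r => /(congr1 val); rewrite /= val_Zp_nat// => p3.
have {p3} pE : p = (3 * (p %/ 3))%N by rewrite mulnC [LHS](divn_eq p 3) p3 addn0.
have {}xE : x = c ^+ 3 ^+ (p %/ 3) / c ^+ 3 ^+ q.
  by apply: (mulIg (c ^+ 3 ^+ q)); rewrite mulgVK xE s0 word_eval_nil mul1g {1}pE expgnA.
(* The exponent [p/3 - q] of [c^3] may be negative, hence the two forms in [cyclic_subgroup]. *)
have [qp|/ltnW pq] := leqP q (p %/ 3).
  by exists (p %/ 3 - q)%N; left; rewrite expgnFr.
by exists (q - p %/ 3)%N; right; rewrite expgnFr// invgF.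
Qed.

End Presented.

Theorem corollary1p6 (R : realType)
    (presentation_QB3 : is_presentation QB3_rels (QB3_gen R)) :
  torsion_free (QB3 R) /\
  group_center (QB3 R) = cyclic_subgroup (Delta R).
Proof.
split; first exact: presented_torsion_free presentation_QB3.
by rewrite (presented_center presentation_QB3) -product_cube.
Qed.
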